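(* Let $E=\{1,\dots,n\}$, $0\le k\le n$, and $p$ a prime. Then: 1. The irreducible elements of the monoid $\mathcal{Q}_p(\mathrm{U}(k,n))$ are exactly the functions $\chi_S$, where $S$ ranges over the irreducible upper sets of the poset $(2^E,\le)$. 2. If $k\ne0$ and $k\ne n$, the monoid $\mathcal{Q}_p(\mathrm{U}(k,n))$ has no prime elements. 3. The only prime element of $\mathcal{Q}_p(\mathrm{U}(0,n))$ is $\chi_{\uparrow\{E\}}$, and the only prime element of $\mathcal{Q}_p(\mathrm{U}(n,n))$ is $\chi_{\uparrow\{\emptyset\}}$.
   Context: $\mathrm{U}(k,n)$ is the uniform matroid on $E$ with rank $\operatorname{rk}(A)=\min(|A|,k)$. The partial order $\le$ on $2^E$ is the reflexive–transitive closure of the relations $A< A\cup\{e\}$ if $\operatorname{rk}(A\cup\{e\})>\operatorname{rk}(A)$ and $A\cup\{e\}<A$ if $\operatorname{rk}(A\cup\{e\})=\operatorname{rk}(A)$ ($e\notin A$). $\mathcal{Q}_p(\mathrm{U}(k,n))=\{v_p\circ m\}$, where $v_p$ is the $p$-adic valuation and $m:2^E\to\mathbb{Z}_{>0}$ ranges over functions with $m(A)\mid m(A\cup\{e\})$ when the rank increases and $m(A\cup\{e\})\mid m(A)$ otherwise; equivalently it is the additive monoid of functions $2^E\to\mathbb{N}$ monotone for $\le$. For a subset $\mathcal{X}$ of the poset, $\uparrow\mathcal{X}$ is the set of elements above some element of $\mathcal{X}$; an upper set is a set with $\uparrow\mathcal{X}=\mathcal{X}$; an irreducible upper set is a nonempty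 upper set not the union of two disjoint nonempty upper sets; $\chi_S$ is the indicator function of $S$. An irreducible element is a nonzero element that is not a sum of two nonzero elements; $a$ is prime if $a$ divides $b+c$ (i.e. $b+c-a$ lies in the monoid) implies $a$ divides $b$ or $a$ divides $c$.
   Formalization: The uniqueness claims in part 3 are stated for n ≠ 1, since for n = 1 the monoid is free on two generators and has two prime elements; prime elements are taken to be nonzero, as 0 would otherwise always be prime. *)

(* Defs.v *)
From HB Require Import structures.
From mathcomp Require Import all_boot all_order all_algebra.

Set Implicit Arguments.
Unset Strict Implicit.
Unset Printing Implicit Defensive.

Import GRing.Theory.
Local Open Scope ring_scope.

(* Arithmetic of a submonoid [M] of an additive monoid [V].  [M] is a bare
   predicate; the definitions are meant for [M] closed under 0 and +. *)
Section Monoid.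
Variables (V : nmodType) (M : V -> Prop).

Definition irreducible_elt (a : V) : Prop :=
  [/\ M a, a <> 0 &
      ~ (exists b c, [/\ M b, M c, b <> 0, c <> 0 & a = b + c])].

(* [b - a] lies in [M], subtraction-free. *)
Definition divides (a b : V) : Prop := exists2 c, M c & b = a + c.

(* 0 divides everything, so it must be excluded explicitly; in the monoids
   below 0 is the only unit. *)
Definition prime_elt (a : V) : Prop :=
  [/\ M a, a <> 0 &
      forall b c, M b -> M c ->
        divides a (b + c) -> divides a b \/ divides a c].
End Monoid.

Section RankPoset.
Variables (T : finType) (rk : {set T} -> nat).
Implicit Types (A B : {set T}) (S X : {set {set T}}).

(* Generating relation [A < B]: either [B] adds one element to [A] and the rank
   increases, or [A] adds one element to [B] and the rank does not change. *)
Definition rank_step : rel {set T} := fun A B =>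
  [exists e, [&& e \notin A, B == e |: A & (rk A < rk B)%N]]
  || [exists e, [&& e \notin B, A == e |: B & rk A == rk B]].

Definition rank_le : rel {set T} := connect rank_step.

Definition up X : {set {set T}} := [set B | [exists A in X, rank_le A B]].

Definition upper_set X : Prop := up X = X.

Definition irreducible_upper_set S : Prop :=
  [/\ S <> set0, upper_set S &
      ~ (exists S1 S2 : {set {set T}},
           [/\ upper_set S1, upper_set S2, S1 <> set0 & S2 <> set0] /\
           [disjoint S1 & S2] /\ S = S1 :|: S2)].

Definition multiplicity (m : {set T} -> nat) : Prop :=
  (forall A, (0 < m A)%N) /\
  (forall A e, e \notin A ->
     if (rk A < rk (e |: A))%N then (m A %| m (e |: A))%N
     else (m (e |: A) %| m A)%N).

(* The carrier {v_p o m}, inside the additive monoid of all functions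
   2^T -> nat; [logn p] is the p-adic valuation on positive integers. *)
Definition Qmonoid (p : nat) (f : {ffun {set T} -> nat}) : Prop :=
  exists2 m, multiplicity m & f = [ffun A => logn p (m A)].
End RankPoset.

Definition chi (T : finType) (S : {set T}) : {ffun T -> nat} :=
  [ffun A => nat_of_bool (A \in S)].

Definition uniform_rk (k n : nat) (A : {set 'I_n}) : nat := minn #|A| k.

(* Main.v *)
(* By monotonicity f splits off chi of its support, and chi S is additively
   indecomposable exactly when S is not a disjoint union of upper sets; so
   irreducible elements, and a fortiori prime ones, are of the form chi S.
   For such an S, primality is refuted by upper sets U, V and a monotone q with
   chi U + chi V = chi S + q, because chi S divides chi U only if S is included
   in U and U \ S is an upper set. *)

Require Import Defs.
From mathcomp Require Import all_boot all_order all_algebra.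

Set Implicit Arguments.
Unset Strict Implicit.
Unset Printing Implicit Defensive.

Import GRing.Theory.

(** * Monotone functions and upper sets of an arbitrary relation *)

Definition monotone (T : finType) (r : rel T) (f : {ffun T -> nat}) : Prop :=
  forall x y, r x y -> f x <= f y.

Definition upper (T : finType) (r : rel T) (S : {set T}) : Prop :=
  forall x y, r x y -> x \in S -> y \in S.

Section Monotone.
Variables (T : finType) (r : rel T).
Implicit Types (f g : {ffun T -> nat}) (S U V : {set T}).

Lemma ffun_natD f g x : (f + g)%R x = f x + g x.
Proof. by rewrite ffunE. Qed.

Lemma ffun_nat0 x : (0 : {ffun T -> nat})%R x = 0.
Proof. by rewrite ffunE. Qed.

Lemma chiE S x : chi S x = (x \in S).
Proof. by rewrite ffunE. Qed.

Lemma monotone_chi S : upper r S -> monotone r (chi S).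
Proof.
move=> uS x y rxy; rewrite !chiE; case: (boolP (x \in S)) => // xS.
by rewrite (uS _ _ rxy xS).
Qed.

Lemma monotoneD f g : monotone r f -> monotone r g -> monotone r (f + g)%R.
Proof. by move=> mf mg x y rxy; rewrite !ffun_natD leq_add ?mf ?mg. Qed.

Lemma upper_setU U V : upper r U -> upper r V -> upper r (U :|: V).
Proof.
move=> uU uV x y rxy; rewrite !in_setU.
by case/orP=> [/(uU _ _ rxy)->|/(uV _ _ rxy)->]; rewrite ?orbT.
Qed.

Lemma upper_setI U V : upper r U -> upper r V -> upper r (U :&: V).
Proof.
move=> uU uV x y rxy; rewrite !in_setI.
by case/andP=> /(uU _ _ rxy)-> /(uV _ _ rxy)->.
Qed.

Lemma chi_neq0 S : S <> set0 -> chi S <> 0%R.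
Proof.
move=> S0 /ffunP chi0; apply: S0; apply/setP => x; rewrite inE.
by move: (chi0 x); rewrite chiE ffun_nat0; case: (x \in S).
Qed.

Lemma upper_support f : monotone r f -> upper r [set x | 0 < f x].
Proof.
by move=> mf x y rxy; rewrite !inE => /leq_trans; apply; exact: mf.
Qed.

Lemma support_neq0 f : f <> 0%R -> [set x | 0 < f x] <> set0.
Proof.
move=> f0 /setP S0; apply: f0; apply/ffunP => x; rewrite ffun_nat0.
by move: (S0 x); rewrite !inE; case: (f x).
Qed.

(** Truncated predecessor preserves order, and [f x] is its support bit plus [(f x).-1]. *)
Lemma monotone_sub_support f : monotone r f ->
  exists2 g, monotone r g & f = (chi [set x | (0 < f x)%N] + g)%R.
Proof.
move=> mf; exists [ffun x => (f x).-1].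
  by move=> x y rxy; rewrite !ffunE -!subn1 leq_sub2r ?mf.
by apply/ffunP => x; rewrite ffun_natD chiE inE ffunE; case: (f x).
Qed.

Lemma irreducible_monotone f : irreducible_elt (monotone r) f ->
  exists S, [/\ upper r S, S <> set0 & f = chi S].
Proof.
case=> mf f0 irr; have [g mg fE] := monotone_sub_support mf.
have S0 := support_neq0 f0; have uS := upper_support mf.
exists [set x | 0 < f x]; split=> //.
case: (eqVneq g 0%R) => [g0|/eqP g0]; first by rewrite {1}fE g0 addr0.
case: irr; exists (chi [set x | 0 < f x]), g.
by split=> //; [exact: monotone_chi | exact: chi_neq0].
Qed.

(** If [b + c] divides [b], then [c] vanishes because values are naturals; so a prime written as
    [b + c] has a zero summand. *)
Lemma prime_irreducible_monotone f :
  prime_elt (monotone r) f -> irreducible_elt (monotone r) f.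
Proof.
have div0 b c : divides (monotone r) (b + c)%R b -> c = 0%R.
  case=> d _ /ffunP bE; apply/ffunP => x; move: (bE x).
  rewrite !ffun_natD ffun_nat0 -addnA -[LHS]addn0 => /addnI /esym/eqP.
  by rewrite addn_eq0 => /andP[/eqP].
case=> mf f0 pf; split=> // -[b [c [mb mc b0 c0 fE]]].
have dbc : divides (monotone r) f (b + c)%R.
  by exists 0%R; rewrite ?addr0 // => x y _; rewrite !ffun_nat0.
case: (pf b c mb mc dbc); rewrite fE; first by move/div0.
by rewrite addrC => /div0.
Qed.

Lemma prime_monotone f : prime_elt (monotone r) f ->
  exists S, [/\ upper r S, S <> set0 & f = chi S].
Proof. by move/prime_irreducible_monotone/irreducible_monotone. Qed.

(** The cofactor is the indicator of [U :\: S], and its monotonicity makes that set upper. *)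
Lemma divides_chi S U : divides (monotone r) (chi S) (chi U) ->
  S \subset U /\ upper r (U :\: S).
Proof.
case=> c mc /ffunP UE.
have cE x : (x \in U : nat) = (x \in S) + c x.
  by move: (UE x); rewrite ffun_natD !chiE.
split.
  by apply/subsetP => x xS; move: (cE x); rewrite xS; case: (x \in U).
move=> x y /mc; move: (cE x) (cE y); rewrite !inE.
by do 4!case: (_ \in _) => //=; rewrite ?add0n ?add1n => <- // [<-].
Qed.

(** The form in which primality gets refuted: [q] is exhibited by comparing membership bits
    pointwise, then both alternatives are excluded. *)
Lemma prime_chi_split S U V q :
    prime_elt (monotone r) (chi S) -> upper r U -> upper r V -> monotone r q ->
    (forall x, (x \in U) + (x \in V) = (x \in S) + q x) ->
  (S \subset U /\ upper r (U :\: S)) \/ (S \subset V /\ upper r (V :\: S)).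
Proof.
case=> _ _ pS uU uV mq UVE.
have dUV : divides (monotone r) (chi S) (chi U + chi V)%R.
  by exists q => //; apply/ffunP => x; rewrite !ffun_natD !chiE.
by case: (pS _ _ (monotone_chi uU) (monotone_chi uV) dUV) => /divides_chi;
  [left | right].
Qed.

(** A monotone function positive at the least point [x0] is positive everywhere, and a sum positive
    at [x0] has a term positive there. *)
Lemma prime_chi_setT x0 : (forall x, r x0 x) ->
  prime_elt (monotone r) (chi [set: T]).
Proof.
move=> r0; have divT f : monotone r f -> 0 < f x0 ->
    divides (monotone r) (chi [set: T]) f.
  move=> mf f0; have [g mg fE] := monotone_sub_support mf; exists g => //.
  suff <- : [set x | 0 < f x] = [set: T] by [].
  by apply/setP => x; rewrite !inE (leq_trans f0) ?mf.
split; first by apply: monotone_chi => x y; rewrite !inE.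
  by apply: chi_neq0 => /setP/(_ x0); rewrite !inE.
move=> b c mb mc [d _ /ffunP/(_ x0)]; rewrite !ffun_natD chiE inE.
case: (posnP (b x0)) => [-> cE|b0 _]; [right|left]; apply: divT => //.
by rewrite -[c x0]add0n cE.
Qed.

Lemma monotone_connect f : monotone (connect r) f <-> monotone r f.
Proof.
split=> mf x y; first by move=> /connect1; apply: mf.
case/connectP=> s; elim: s x => [x _ ->//|z s IHs x /= /andP[/mf xz zs] yE].
exact: leq_trans xz (IHs _ zs yE).
Qed.

Lemma upper_connect S : upper (connect r) S <-> upper r S.
Proof.
split=> uS x y; first by move=> /connect1; apply: uS.
case/connectP=> s; elim: s x => [x _ ->//|z s IHs x /= /andP[/uS xz zs] yE].
by move/xz; apply: IHs.
Qed.

End Monotone.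

(** * Transfer between equivalent submonoids *)

Lemma prime_elt_congr (V : nmodType) (M N : V -> Prop) a :
  (forall b, M b <-> N b) -> prime_elt M a <-> prime_elt N a.
Proof.
move=> MN.
have dMN b c : divides M b c <-> divides N b c.
  by split=> -[d /MN Md cE]; exists d.
split=> -[Ma a0 pa]; split=> //; try exact/MN.
- move=> b c /MN Mb /MN Mc /dMN /(pa _ _ Mb Mc).
  by case=> /dMN; [left|right].
- move=> b c /MN Mb /MN Mc /dMN /(pa _ _ Mb Mc).
  by case=> /dMN; [left|right].
Qed.

Lemma irreducible_elt_congr (V : nmodType) (M N : V -> Prop) a :
  (forall b, M b <-> N b) -> irreducible_elt M a <-> irreducible_elt N a.
Proof.
move=> MN; split=> -[Ma a0 ia]; split=> //; try exact/MN.
- by move=> [b [c [/MN Mb /MN Mc b0 c0 aE]]]; apply: ia; exists b, c.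
- by move=> [b [c [/MN Mb /MN Mc b0 c0 aE]]]; apply: ia; exists b, c.
Qed.

(** * Valuations of multiplicities as monotone functions on the rank poset *)

Section RankMonoid.
Variables (T : finType) (rk : {set T} -> nat).
Implicit Types (f : {ffun {set T} -> nat}) (S X : {set {set T}}).

Lemma upper_setP S : upper_set rk S <-> upper (rank_step rk) S.
Proof.
apply: iff_trans (upper_connect _ _); split=> [<- A B AB|uS].
  rewrite !inE => /exists_inP[C CS CA]; apply/exists_inP; exists C => //.
  exact: connect_trans CA AB.
apply/setP => B; rewrite inE; apply/exists_inP/idP => [[A AS AB]|BS].
  exact: uS AB AS.
by exists B => //; exact: connect0.
Qed.

Hypothesis rk_mono : forall A e, rk A <= rk (e |: A).

(** Valuations respect divisibility; conversely [f] is the valuation of [p ^ f A]. *)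
Lemma QmonoidP p f : prime p ->
  Qmonoid rk p f <-> monotone (rank_step rk) f.
Proof.
move=> p_pr; split=> [[m [m_gt0 m_dvd] ->] A B|mf].
  rewrite !ffunE => /orP[] /existsP[e] /and3P[eA /eqP-> rkAB];
    apply: dvdn_leq_log => //; have := m_dvd _ _ eA.
    by rewrite rkAB.
  by rewrite (eqP rkAB) ltnn.
exists (fun A => p ^ f A); last first.
  by apply/ffunP => A; rewrite ffunE pfactorK.
split=> [A|A e eA]; first by rewrite expn_gt0 prime_gt0.
case: ifP => [rkA|/negbT rkA]; apply: dvdn_exp2l; apply: mf; apply/orP.
  by left; apply/existsP; exists e; rewrite eA rkA eqxx.
(* Without a strict increase the ranks are equal, by [rk_mono]. *)
right; apply/existsP; exists e; rewrite eA eqxx /=.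
by rewrite eqn_leq rk_mono leqNgt rkA.
Qed.

Lemma irreducible_QmonoidP p f : prime p ->
  irreducible_elt (Qmonoid rk p) f <->
  exists2 S, irreducible_upper_set rk S & f = chi S.
Proof.
move=> p_pr; apply: iff_trans (irreducible_elt_congr _ (fun g => QmonoidP g p_pr)) _.
split=> [irr|[S [S0 /upper_setP uS dS] ->]].
  have [S [uS S0 fE]] := irreducible_monotone irr; exists S => //.
  split=> //; first exact/upper_setP.
  case=> S1 [S2 [[/upper_setP u1 /upper_setP u2 n1 n2] [d12 S12]]].
  case: irr => _ _; case; exists (chi S1), (chi S2).
  split; try exact: monotone_chi; try exact: chi_neq0.
  apply/ffunP => A; rewrite fE ffun_natD !chiE S12 inE.
  by case: (boolP (A \in S1)) => //= /(disjointFr d12) ->.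
split; [exact: monotone_chi | exact: chi_neq0 |].
(* Since [chi S] is at most 1, the supports of [b] and [c] are disjoint, and their union is [S]. *)
case=> b [c [mb mc b0 c0 /ffunP SE]]; apply: dS.
exists [set A | 0 < b A], [set A | 0 < c A]; split; split.
- exact/upper_setP/upper_support.
- exact/upper_setP/upper_support.
- exact: support_neq0.
- exact: support_neq0.
- rewrite disjoint_subset; apply/subsetP => A; rewrite !inE.
  move: (SE A); rewrite ffun_natD chiE.
  by case: (A \in S); case: (b A) => [|[|?]]; case: (c A).
- apply/setP => A; rewrite !inE; move: (SE A); rewrite ffun_natD chiE.
  by case: (A \in S); case: (b A) => [|[|?]]; case: (c A).
Qed.

End RankMonoid.

(** Precomposition with an involution is an additive automorphism. It serves for complementation,
    which turns the rank 0 order into inclusion. *)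
Lemma prime_elt_reindex (T : finType) (h : T -> T)
    (M N : {ffun T -> nat} -> Prop) f :
    involutive h -> (forall g, M g <-> N [ffun x => g (h x)]) ->
  prime_elt M f -> prime_elt N [ffun x => f (h x)].
Proof.
move=> hK MN.
pose phi (g : {ffun T -> nat}) := [ffun x => g (h x)].
have phiK : involutive phi by move=> g; apply/ffunP => x; rewrite !ffunE hK.
have phiD : {morph phi : a b / (a + b)%R}.
  by move=> a b; apply/ffunP => x; rewrite !ffunE.
have NM g : N g <-> M (phi g) by apply: iff_sym; have := MN (phi g);
    rewrite -/(phi (phi g)) phiK.
have dMN a b : divides M (phi a) (phi b) -> divides N a b.
  case=> c Mc bE; exists (phi c); first by apply/NM; rewrite phiK.
  by rewrite -[b]phiK bE phiD !phiK.
have dNM a b : divides N (phi a) b -> divides M a (phi b).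
  by case=> c /NM Mc ->; exists (phi c); rewrite // phiD phiK.
case=> Mf f0 pf; rewrite -/(phi f); split; first exact/MN.
  by move=> /(congr1 phi); rewrite phiK => fE; apply: f0; rewrite fE;
     apply/ffunP => x; rewrite !ffunE.
move=> b c /NM Mb /NM Mc /dNM; rewrite phiD => /(pf _ _ Mb Mc) [] dvd.
  by left; apply: dMN; rewrite phiK.
by right; apply: dMN; rewrite phiK.
Qed.

(** * Primes for inclusion on a power set *)

Definition incl (T : finType) : rel {set T} := fun A B => A \subset B.

Section BooleanLattice.
Variable T : finType.
Implicit Types (A B : {set T}) (S : {set {set T}}).

Lemma subset_connect (r : rel {set T}) A B :
    (forall (C : {set T}) e, e \notin C -> r C (e |: C)) ->
  A \subset B -> connect r A B.
Proof.
move=> rU; move: {2}#|B :\: A| (leqnn #|B :\: A|) => m.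
elim: m A => [|m IHm] A.
  rewrite leqn0 cards_eq0 setD_eq0 => BA AB.
  have -> : A = B by apply/eqP; rewrite eqEsubset AB.
  exact: connect0.
move=> BAm AB; case: (set_0Vmem (B :\: A)) => [/eqP|[e /setDP[eB eA]]].
  rewrite setD_eq0 => BA.
  have -> : A = B by apply/eqP; rewrite eqEsubset AB.
  exact: connect0.
apply: connect_trans (connect1 (rU _ _ eA)) (IHm _ _ _); last first.
  by rewrite subUset sub1set eB.
rewrite -ltnS (leq_trans _ BAm) // setUC -setDDl.
by rewrite [in ltnRHS](cardsD1 e) !inE eA eB.
Qed.

(** Adding missing points one at a time shows that the closure of [r] is inclusion. *)
Lemma monotone_inclP (r : rel {set T}) f :
    (forall (C : {set T}) e, e \notin C -> r C (e |: C)) ->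
    (forall A B, r A B -> A \subset B) ->
  monotone r f <-> monotone (@incl T) f.
Proof.
move=> rU r_sub; split=> [/monotone_connect mf A B AB|mf A B /r_sub].
  by apply: mf; apply: subset_connect.
exact: mf.
Qed.

(* If [set t] is in S, then chi (S \ t) + chi W = chi S + chi (W \ t) for every
   upper set W containing [set t] but not set0.  Otherwise some minimal y in S
   has two points x1, x2, and the up-closures of y \ x1 and y \ x2 meet
   inside S. *)
Lemma prime_chi_incl S : #|T| <> 1 -> upper (@incl T) S -> S <> set0 ->
  prime_elt (monotone (@incl T)) (chi S) -> S = [set: {set T}].
Proof.
move=> T1 uS /eqP/set0Pn[Y YS] pS.
suff S0 : set0 \in S.
  by apply/setP => A; rewrite inE; apply: uS S0; apply: sub0set.
apply/negPn/negP => S0.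
have [/existsP[t tS]|noS1] := boolP [exists t, [set t] \in S].
  have [u ut] : exists u, u != t.
    apply/existsP; rewrite -[[exists _, _]]negbK negb_exists; apply/negP.
    move=> /forallP eq_t; apply: T1; apply: (@eq_card1 _ t) => x.
    by rewrite !inE; apply/esym/idP; have := eq_t x; rewrite negbK.
  have tmin A : A \subset [set t] -> A != set0 -> A = [set t].
    by rewrite subset1 => /orP[/eqP //|->].
  (* Only [set0] lies strictly below [[set t]], and it is not in [S], so deleting [[set t]] keeps
     the set upper. *)
  have uSt : upper (@incl T) (S :\ [set t]).
    move=> A B AB; rewrite !in_setD1 => /andP[At AS].
    rewrite (uS _ _ AB AS) andbT; apply: contraNneq At => Bt.
    apply/eqP/tmin; first by rewrite -Bt.
    by apply: contraNneq S0 => <-.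
  have split_t W : upper (@incl T) W -> [set t] \in W -> set0 \notin W ->
      S \subset W /\ upper (@incl T) (W :\: S).
    move=> uW tW W0.
    have uWt : upper (@incl T) (W :\ [set t]).
      move=> A B AB; rewrite !in_setD1 => /andP[At AW].
      rewrite (uW _ _ AB AW) andbT; apply: contraNneq At => Bt.
      apply/eqP/tmin; first by rewrite -Bt.
      by apply: contraNneq W0 => <-.
    have [A|[/subsetP/(_ _ tS)]|//] :=
      prime_chi_split pS uSt uW (monotone_chi uWt).
      by rewrite chiE !in_setD1; case: eqP => [->|_] //=; rewrite tS tW.
    by rewrite !inE eqxx.
  (* If [[set u]] is in [S] too, the sets containing [t] form a [W] that misses it. *)
  have [uS1|uS1] := boolP ([set u] \in S).
    have [|||/subsetP/(_ _ uS1) uW _] := split_t [set A : {set T} | t \in A].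
    - by move=> A B /subsetP AB; rewrite !inE; apply: AB.
    - by rewrite !inE.
    - by rewrite !inE.
    - by move: uW; rewrite !inE eq_sym (negPf ut).
  (* Otherwise [W] is all nonempty sets: [[set u]] is in [W :\: S], but the larger [[set u; t]] is
     in [S]. *)
  have [|||_ uW] := split_t [set A : {set T} | A != set0].
  - move=> A B AB; rewrite !inE; apply: contraNneq => B0.
    by rewrite -subset0 -B0.
  - by rewrite !inE -card_gt0 cards1.
  - by rewrite !inE eqxx.
  have := uW [set u] [set u; t]; rewrite /incl subsetUl !inE => /(_ isT).
  rewrite uS1 -card_gt0 cards1 => /(_ isT) /andP[/negP[]].
  by apply: uS tS; apply: subsetUr.
have [y /minsetP[yS ymin] _] := minset_exists (P := fun A => A \in S) YS.
have [x1 x1y] : exists x, x \in y.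
  by apply/set0Pn; apply: contraNneq S0 => <-.
(* No singleton is in [S], so [y] has a second point. *)
have [x2 /setD1P[x21 x2y]] : exists x, x \in y :\ x1.
  apply/set0Pn; apply: contraNneq noS1 => y0; apply/existsP; exists x1.
  by rewrite -(setD1K x1y) y0 setU0 in yS.
have yD x : x \in y -> y :\ x \notin S.
  move=> xy; apply/negP => /ymin/(_ (subsetDl _ _))/setP/(_ x).
  by rewrite !inE eqxx xy.
(* [W x :\: S] contains [y :\ x] but not the larger [y], so it is not upper. *)
pose W x := S :|: [set A : {set T} | y :\ x \subset A].
have uW x : upper (@incl T) (W x).
  move=> A B AB; rewrite !inE => /orP[/(uS _ _ AB)->//|yA].
  by rewrite (subset_trans yA AB) orbT.
have notW x : x \in y -> ~ upper (@incl T) (W x :\: S).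
  move=> xy /(_ (y :\ x) y (subsetDl _ _)).
  by rewrite !inE yS yD // subxx orbT => /(_ isT).
(* As [W x1] and [W x2] meet exactly in [S], the remainder [q] is the indicator of their union. *)
have [A|[_ /notW]|[_ /notW]] :=
  prime_chi_split pS (uW x1) (uW x2)
                  (monotone_chi (upper_setU (uW x1) (uW x2))); try by apply.
rewrite chiE !inE; have [AS|AS] //= := boolP (A \in S).
case: (boolP (y :\ x1 \subset A)) => //= y1A.
case: (boolP (y :\ x2 \subset A)) => //= y2A.
case/negP: AS; apply: uS yS; apply/subsetP => x xy.
have [xx1|xx1] := eqVneq x x1.
  by apply: (subsetP y2A); rewrite !inE xx1 eq_sym x21.
by apply: (subsetP y1A); rewrite !inE xx1.
Qed.

Lemma prime_incl f : #|T| <> 1 ->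
  prime_elt (monotone (@incl T)) f -> f = chi [set: {set T}].
Proof.
move=> T1 pf; have [S [uS S0 fE]] := prime_monotone pf.
by rewrite fE (@prime_chi_incl S) // -fE.
Qed.

End BooleanLattice.

(** * The order of a uniform matroid and its primes *)

Section Uniform.
Variable n : nat.
Implicit Types (A B C : {set 'I_n}) (f : {ffun {set 'I_n} -> nat}).

Lemma uniform_rkU1 k A e : uniform_rk k A <= uniform_rk k (e |: A).
Proof.
rewrite /uniform_rk leq_min geq_minr andbT.
by rewrite (leq_trans (geq_minl _ _)) ?subset_leq_card ?subsetUr.
Qed.

(** The rank grows with the cardinality up to [k] and is constant from there on, so every step moves
    towards the bases. *)
Lemma uniform_stepP k A B : rank_step (@uniform_rk k n) A B ->
  (A \subset B /\ #|A| < #|B| <= k) \/ (B \subset A /\ k <= #|B| < #|A|).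
Proof.
rewrite /rank_step /uniform_rk.
case/orP=> /existsP[e /and3P[eA /eqP-> rkAB]]; [left|right];
  rewrite subsetUr; split=> //; move: rkAB; rewrite cardsU1 eA add1n.
  case: (ltnP #|A| k) => [Ak _|Ak]; first by rewrite ltnS leqnn.
  by rewrite ltnNge geq_minr.
rewrite leqnn andbT; case: (leqP k #|B|) => // Bk.
by rewrite (minn_idPl Bk) eqn_leq ltnn.
Qed.

Lemma uniform_step_up k A e : e \notin A -> #|A| < k ->
  rank_step (@uniform_rk k n) A (e |: A).
Proof.
move=> eA Ak; apply/orP; left; apply/existsP; exists e.
rewrite eA eqxx /uniform_rk cardsU1 eA add1n /=.
by rewrite (minn_idPl Ak) (minn_idPl (ltnW Ak)).
Qed.

Lemma uniform_step_down k A e : e \notin A -> k <= #|A| ->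
  rank_step (@uniform_rk k n) (e |: A) A.
Proof.
move=> eA Ak; apply/orP; right; apply/existsP; exists e.
rewrite eA eqxx /uniform_rk cardsU1 eA add1n /=.
by rewrite (minn_idPr Ak) (minn_idPr (leqW Ak)).
Qed.

Lemma card_lt_ord A e : e \notin A -> #|A| < n.
Proof.
move=> eA; rewrite -[n in _ < n]card_ord -(cardsT 'I_n).
by apply: proper_card; rewrite properT; apply: contraNneq eA => ->.
Qed.

Lemma uniform_full_step A e : e \notin A -> rank_step (@uniform_rk n n) A (e |: A).
Proof. by move=> eA; apply: uniform_step_up => //; apply: card_lt_ord eA. Qed.

(** A downward step would start from a set of more than [n] points. *)
Lemma monotone_uniform_full f :
  monotone (rank_step (@uniform_rk n n)) f <-> monotone (@incl 'I_n) f.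
Proof.
apply: monotone_inclP; first exact: uniform_full_step.
move=> A B /uniform_stepP[[]|[_ /andP[nB /(leq_ltn_trans nB)]]] //.
by rewrite ltnNge -[n in _ <= n]card_ord max_card.
Qed.

Lemma monotone_uniform_null f :
  monotone (rank_step (@uniform_rk 0 n)) f <->
  monotone (@incl 'I_n) [ffun A => f (~: A)].
Proof.
(* In rank 0 every step removes a point; between complements it adds one. *)
pose r A B := rank_step (@uniform_rk 0 n) (~: A) (~: B).
apply: (@iff_trans _ (monotone r [ffun A => f (~: A)])).
  split=> mf A B rAB; first by rewrite !ffunE mf.
  by have := mf (~: A) (~: B); rewrite /r !ffunE !setCK; apply.
apply: monotone_inclP => [C e eC|A B].
  rewrite /r; have -> : ~: C = e |: ~: (e |: C).
    by apply/setP => x; rewrite !inE; case: eqP => // ->.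
  by apply: uniform_step_down; rewrite // !inE eqxx.
by case/uniform_stepP=> [[_ /andP[/leq_trans ltA /ltA]]|[]] //; rewrite setCS.
Qed.

(** Take a member of [S] whose cardinality is nearest to [k], the distance being a sum of truncated
    differences: a step towards [k] stays in [S] and would be nearer. *)
Lemma upper_uniform_basis k (S : {set {set 'I_n}}) : k <= n ->
  upper (rank_step (@uniform_rk k n)) S -> S <> set0 ->
  exists2 B, B \in S & #|B| = k.
Proof.
move=> kn uS /eqP/set0Pn[Y YS].
have [B BS Bmin] :=
  arg_minnP (fun B : {set 'I_n} => (#|B| - k) + (k - #|B|)) YS.
exists B => //; have [Bk|Bk|//] := ltngtP #|B| k.
  have [e _ eB] : exists2 e, e \in [set: 'I_n] & e \notin B.
    by apply/subsetPn; apply: contraL Bk => /subset_leq_card;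
      rewrite cardsT card_ord -leqNgt; apply: leq_trans.
  have := Bmin _ (uS _ _ (uniform_step_up eB Bk) BS).
  rewrite cardsU1 eB add1n (eqP (Bk : _ - k == 0)) (eqP (ltnW Bk : _ == 0)).
  by rewrite !add0n leqNgt subnS prednK ?subn_gt0 // leqnn.
have [e eB] : exists e, e \in B by apply/set0Pn; rewrite -card_gt0; case: #|B| Bk.
have cB : #|B| = #|B :\ e|.+1 by rewrite (cardsD1 e) eB.
have eBe : e \notin B :\ e by rewrite !inE eqxx.
have kBe : k <= #|B :\ e| by rewrite -ltnS -cB.
have := uniform_step_down eBe kBe; rewrite setD1K // => /uS/(_ BS)/Bmin.
rewrite cB (eqP (kBe : _ == 0)) (eqP (leqW kBe : _ == 0)) !addn0.
by rewrite subSn // ltnn.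
Qed.

(* Unless S lies inside Lo :&: Hi, the split comes from
   chi (S :|: U) + chi (S :&: U) = chi S + chi U with U one of Lo, Hi, or from
   chi (S :&: Lo) + chi (S :&: Hi) = chi S + chi (S :&: (Lo :&: Hi)). *)
Lemma not_prime_uniform k f : 0 < k < n ->
  ~ prime_elt (monotone (rank_step (@uniform_rk k n))) f.
Proof.
move=> /andP[k0 kn] pf; have [S [uS S0 fE]] := prime_monotone pf.
rewrite {}fE in pf; set r := rank_step _ in pf uS.
pose Lo := [set A : {set 'I_n} | #|A| <= k].
pose Hi := [set A : {set 'I_n} | k <= #|A|].
have uLo : upper r Lo.
  move=> A B /uniform_stepP[[_ /andP[_ Bk _]]|[_ /andP[_ BA]]]; rewrite !inE //.
  by apply: leq_trans; apply: ltnW.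
have uHi : upper r Hi.
  move=> A B /uniform_stepP[[_ /andP[AB _]]|[_ /andP[kB _ _]]]; rewrite !inE //.
  by move=> /leq_trans; apply; apply: ltnW.
have [B BS Bk] := upper_uniform_basis (ltnW kn) uS S0.
(* Here [0 < k] gives [x] and [k < n] gives [z]: the sets [B :\ x] and [z |: B] step to [B] from the
   two sides. *)
have [x xB] : exists x, x \in B by apply/set0Pn; rewrite -card_gt0 Bk.
have [z _ zB] : exists2 z, z \in [set: 'I_n] & z \notin B.
  apply/subsetPn; apply: contraL kn => /subset_leq_card.
  by rewrite cardsT card_ord Bk leqNgt.
have BxE : #|B :\ x| = k.-1 by rewrite -Bk (cardsD1 x B) xB.
have BzE : #|z |: B| = k.+1 by rewrite cardsU1 zB Bk.
have rBx : r (B :\ x) B.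
  rewrite -[B in r _ B](setD1K xB); apply: uniform_step_up; first by rewrite !inE eqxx.
  by rewrite BxE prednK.
have rBz : r (z |: B) B by apply: uniform_step_down; rewrite // Bk.
have BxLo : B :\ x \in Lo by rewrite inE BxE leq_pred.
have BxHi : B :\ x \notin Hi by rewrite inE BxE -ltnNge ltn_predL.
have BzLo : z |: B \notin Lo by rewrite inE BzE ltnn.
have BzHi : z |: B \in Hi by rewrite inE BzE.
(* A step from [U :\: S] to [B] leaves [U :\: S], because [B] is in [S]. *)
have notD (U : {set {set 'I_n}}) A :
    r A B -> A \in U -> A \notin S -> ~ upper r (U :\: S).
  by move=> rAB AU AS /(_ _ _ rAB); rewrite !inE AU AS BS => /(_ isT).
(* [Y] rules out that [S] is included in [S :&: U], so the other alternative holds. *)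
have splitU (U : {set {set 'I_n}}) Y :
    upper r U -> Y \in S -> Y \notin U -> upper r ((S :|: U) :\: S).
  move=> uU' YS YU.
  have [A|[//]|[/subsetP/(_ _ YS)]] :=
    prime_chi_split pf (upper_setU uS uU') (upper_setI uS uU') (monotone_chi uU').
    by rewrite chiE !inE; do 2!case: (_ \in _).
  by rewrite inE (negPf YU) andbF.
have [/subsetP SLo|/subsetPn[Y YS YLo]] := boolP (S \subset Lo);
have [/subsetP SHi|/subsetPn[X XS XHi]] := boolP (S \subset Hi).
(* Now [S] consists of bases. The indicators of [Lo] and [Hi] add up to 1 everywhere plus 1 on
   bases; no step leaves a basis, so the bases outside [S] form an upper set. *)
- have q_mono : monotone r (chi [set: {set 'I_n}] + chi ((Lo :&: Hi) :\: S))%R.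
    apply: monotoneD; apply: monotone_chi => A C rAC; rewrite !inE //.
    move=> /and3P[_ Ak kA]; case/uniform_stepP: rAC => -[_ /andP[]].
      by move=> AC /(leq_trans AC); rewrite ltnNge kA.
    by move=> kC CA; move: (leq_ltn_trans kC CA); rewrite ltnNge Ak.
  have [A|[_ /(notD Lo _ rBx BxLo)[]]|[_ /(notD Hi _ rBz BzHi)[]]] :=
    prime_chi_split pf uLo uHi q_mono.
  + rewrite ffun_natD !chiE !inE.
    case: (boolP (A \in S)) => [AS|_] /=; last by case: ltngtP.
    by have := SLo _ AS; have := SHi _ AS; rewrite !inE => -> ->.
  + by apply: contra BxHi => /SHi.
  + by apply: contra BzLo => /SLo.
- apply: (notD (S :|: Hi) _ rBz) (splitU _ _ uHi XS XHi).
    by rewrite inE BzHi orbT.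
  by apply: contra BzLo => /SLo.
- apply: (notD (S :|: Lo) _ rBx) (splitU _ _ uLo YS YLo).
    by rewrite inE BxLo orbT.
  by apply: contra BxHi => /SHi.
(* [S] leaves both [Lo] and [Hi], so neither intersection contains [S]. *)
have uLH := upper_setI uS (upper_setI uLo uHi).
have [A|[/subsetP/(_ _ YS)]|[/subsetP/(_ _ XS)]] :=
  prime_chi_split pf (upper_setI uS uLo) (upper_setI uS uHi) (monotone_chi uLH).
- by rewrite chiE !inE; case: (A \in S) => //=; case: ltngtP.
- by rewrite inE (negPf YLo) andbF.
- by rewrite inE (negPf XHi) andbF.
Qed.

Lemma rank_le_uniform_full A : rank_le (@uniform_rk n n) set0 A.
Proof. by apply: subset_connect (sub0set A) => C e; apply: uniform_full_step. Qed.

Lemma rank_le_uniform_null A : rank_le (@uniform_rk 0 n) [set: 'I_n] A.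
Proof.
(* Reversed steps add points, so [subset_connect] applies to the reversed relation. *)
rewrite /rank_le; have /= <- := connect_rev (rank_step (@uniform_rk 0 n)) A setT.
by apply: subset_connect (subsetT A) => C e eC; apply: uniform_step_down.
Qed.

Lemma prime_QmonoidP k p f : prime p ->
  prime_elt (Qmonoid (@uniform_rk k n) p) f <->
  prime_elt (monotone (rank_step (@uniform_rk k n))) f.
Proof.
move=> p_pr; apply: prime_elt_congr => g.
by apply: QmonoidP p_pr; apply: uniform_rkU1.
Qed.

End Uniform.

(** * Least elements and the final assembly *)

Lemma up_least (T : finType) (rk : {set T} -> nat) A :
  (forall B, rank_le rk A B) -> up rk [set A] = [set: {set T}].
Proof.
move=> rA; apply/setP => B; rewrite !inE; apply/exists_inP.
by exists A; rewrite ?inE.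
Qed.

Lemma prime_Qmonoid_least n k p A : prime p ->
    (forall B, rank_le (@uniform_rk k n) A B) ->
  prime_elt (Qmonoid (@uniform_rk k n) p) (chi (up (@uniform_rk k n) [set A])).
Proof.
move=> p_pr rA; rewrite up_least //; apply/prime_QmonoidP => //.
(* The least point is related to every other only in the closure, hence the passage to [connect]. *)
by apply/(prime_elt_congr _ (monotone_connect _)); apply: prime_chi_setT rA.
Qed.

(** Uniqueness in the third part assumes [n <> 1]: for [n = 1] the order is a two-element chain, the
    monoid is free on two generators, and both are prime. *)
Theorem theorem30 (n k p : nat) (hk : k <= n) (hp : prime p) :
  (forall f : {ffun {set 'I_n} -> nat},
     irreducible_elt (Qmonoid (@uniform_rk k n) p) f <->
     exists2 S : {set {set 'I_n}},
       irreducible_upper_set (@uniform_rk k n) S & f = chi S)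
  /\
  (k <> 0 -> k <> n ->
     forall f : {ffun {set 'I_n} -> nat},
       ~ prime_elt (Qmonoid (@uniform_rk k n) p) f)
  /\
  ((prime_elt (Qmonoid (@uniform_rk 0 n) p)
      (chi (up (@uniform_rk 0 n) [set [set: 'I_n]])) /\
    (n <> 1 -> forall f : {ffun {set 'I_n} -> nat},
       prime_elt (Qmonoid (@uniform_rk 0 n) p) f ->
       f = chi (up (@uniform_rk 0 n) [set [set: 'I_n]])))
   /\
   (prime_elt (Qmonoid (@uniform_rk n n) p)
      (chi (up (@uniform_rk n n) [set set0])) /\
    (n <> 1 -> forall f : {ffun {set 'I_n} -> nat},
       prime_elt (Qmonoid (@uniform_rk n n) p) f ->
       f = chi (up (@uniform_rk n n) [set set0])))).
Proof.
split; first by move=> f; apply: irreducible_QmonoidP => // A e; apply: uniform_rkU1.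
split.
  move=> /eqP k0 /eqP kn f /(prime_QmonoidP _ _ hp); apply: not_prime_uniform.
  by rewrite lt0n k0 ltn_neqAle kn hk.
have In1 : n <> 1 -> #|'I_n| <> 1 by rewrite card_ord.
split; split; try exact: prime_Qmonoid_least (@rank_le_uniform_null n).
- move=> /In1 n1 f /(prime_QmonoidP _ _ hp).
  (* Complementation carries the prime to one for inclusion; the constant function 1 is invariant
     under it. *)
  move/(prime_elt_reindex (@setCK _) (@monotone_uniform_null n)).
  move=> /(prime_incl n1)/ffunP fE; rewrite up_least; last exact: rank_le_uniform_null.
  by apply/ffunP => A; move: (fE (~: A)); rewrite !ffunE !inE setCK.
- exact: prime_Qmonoid_least (@rank_le_uniform_full n).
- move=> /In1 n1 f /(prime_QmonoidP _ _ hp).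
  move=> /(prime_elt_congr _ (@monotone_uniform_full n))/(prime_incl n1) ->.
  by rewrite up_least //; apply: rank_le_uniform_full.
Qed.
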